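(* Let $\mathcal{C}$ be a set and let $\operatorname{postLie}(\mathcal{C}) := \{\mathfrak{g},[\cdot,\cdot],\triangleright\}$, where $\mathfrak{g}$ is the free Lie algebra over the set $\mathrm{OT}_{\mathcal{C}}$ of planar rooted trees with nodes coloured by $\mathcal{C}$, and $\triangleright$ is the extension to $\mathfrak{g}$ of the left grafting product of trees. For any post-Lie algebra $\{\mathcal{A},[\cdot,\cdot],\triangleright\}$ and any function $f\colon \mathcal{C}\to \mathcal{A}$, there exists a unique morphism of post-Lie algebras $\mathcal{F}\colon \operatorname{postLie}(\mathcal{C})\to \mathcal{A}$ such that $\mathcal{F}(c)=f(c)$ for all $c\in\mathcal{C}$.
   Context: All algebras are vector spaces over a field $\mathrm{k}$ of characteristic $0$ and all products are $\mathrm{k}$-bilinear. Associator: $a_{\triangleright}(x,y,z) := x\triangleright(y\triangleright z)-(x\triangleright y)\triangleright z$. Post-Lie algebra: a Lie algebra $\{\mathcal{A},[\cdot,\cdot]\}$ together with a bilinear product $\triangleright\colon\mathcal{A}\times\mathcal{A}\to\mathcal{A}$ such that for all $x,y,z\in\mathcal{A}$: $x\triangleright[y,z]=[x\triangleright y,z]+[y,x\triangleright z]$ and $[x,y]\triangleright z=a_\triangleright(x,y,z)-a_\triangleright(y,x,z)$. A morphism of post-Lie algebras is a linear map preserving both $[\cdot,\cdot]$ and $\triangleright$. Planar trees: $\mathrm{OT}_{\mathcal{C}}$ is the free magma on the set $\mathcal{C}$, with magma operation $\star$. It is identified with the set of planar (ordered) rooted trees with nodes coloured by $\mathcal{C}$: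 $c\in\mathcal{C}$ is the one-node tree, and $\tau_1\star\tau_2$ is the tree obtained by attaching the root of $\tau_1$ as the leftmost branch of the root of $\tau_2$. Every $\tau\in\mathrm{OT}_{\mathcal{C}}$ has a unique factorization $\tau=\tau_1\star(\tau_2\star(\cdots(\tau_k\star c)))$ with $c\in\mathcal{C}$, $k\ge 0$, $\tau_i\in\mathrm{OT}_{\mathcal{C}}$. Left grafting: $\triangleright\colon\mathrm{OT}_{\mathcal{C}}\times\mathrm{OT}_{\mathcal{C}}\to\mathrm{k}\{\mathrm{OT}_{\mathcal{C}}\}$ (the free vector space on $\mathrm{OT}_{\mathcal{C}}$, with $\star$ extended bilinearly) is defined recursively by $\tau\triangleright c:=\tau\star c$ for $c\in\mathcal{C}$, and $$\tau\triangleright(\tau_1\star(\cdots(\tau_k\star c))) := \tau\star(\tau_1\star(\cdots(\tau_k\star c)))+\sum_{i=1}^k \tau_1\star(\cdots((\tau\triangleright\tau_i)\star(\cdots(\tau_k\star c)))).$$ Extension to the free Lie algebra: on the free Lie algebra $\mathfrak{g}$ over the set $\mathrm{OT}_{\mathcal{C}}$, $\triangleright$ is the bilinear extension of left grafting determined by $u\triangleright[v,w]=[u\triangleright v,w]+[v,u\triangleright w]$ and $[u,v]\triangleright w=a_\triangleright(u,v,w)-a_\triangleright(v,u,w)$ for all $u,v,w\in\mathfrak{g}$; with this product $\mathfrak{g}$ is a post-Lie algebra. The set $\mathcal{C}$ is regarded as a subset of $\mathrm{OT}_{\mathcal{C}}\subset\mathfrak{g}$. *)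

(* Defs.v *)
From HB Require Import structures.
From mathcomp Require Import all_boot all_order all_algebra finmap.
From mathcomp Require Import boolp functions.
From mathcomp Require Import monalg.

Set Implicit Arguments.
Unset Strict Implicit.
Unset Printing Implicit Defensive.

Import GRing.Theory.
Local Open Scope ring_scope.

HB.mixin Record Lmodule_isLieAlgebra (k : fieldType) V of GRing.Lmodule k V := {
  lie : V -> V -> V;
  lie_linearl : forall y, linear (lie^~ y);
  lie_linearr : forall x, linear (lie x);
  liexx : forall x, lie x x = 0;
  lie_jacobi : forall x y z,
    lie x (lie y z) + lie y (lie z x) + lie z (lie x y) = 0
}.

#[short(type="lieAlgType")]
HB.structure Definition LieAlgebra (k : fieldType) :=
  {V of GRing.Lmodule k V & Lmodule_isLieAlgebra k V}.

Notation "[ 'Lie' x , y ]" := (lie x y)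
  (at level 0, format "[ 'Lie'  x ,  y ]") : ring_scope.

Definition associator (V : zmodType) (op : V -> V -> V) (x y z : V) : V :=
  op x (op y z) - op (op x y) z.

HB.mixin Record LieAlgebra_isPostLie (k : fieldType) V of LieAlgebra k V := {
  tri : V -> V -> V;
  tri_linearl : forall y, linear (tri^~ y);
  tri_linearr : forall x, linear (tri x);
  tri_lier : forall x y z : V, tri x [Lie y, z] = [Lie tri x y, z] + [Lie y, tri x z];
  tri_liel : forall x y z : V,
    tri [Lie x, y] z = associator tri x y z - associator tri y x z
}.

#[short(type="postLieType")]
HB.structure Definition PostLie (k : fieldType) :=
  {V of LieAlgebra k V & LieAlgebra_isPostLie k V}.

Notation "x |> y" := (tri x y) (at level 45, no associativity) : ring_scope.

Definition is_lie_morphism (k : fieldType) (U V : lieAlgType k) (F : U -> V) : Prop :=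
  linear F /\ {morph F : x y / [Lie x, y]}.

Definition is_postLie_morphism (k : fieldType) (U V : postLieType k) (F : U -> V)
    : Prop :=
  [/\ linear F, {morph F : x y / [Lie x, y]} & {morph F : x y / x |> y}].

Section LinExt.
Context (k : fieldType) (K : choiceType) (V : lmodType k) (h : K -> V).

(* Linear extension to the free vector space on K of a map defined on K. *)
Definition lin_ext (g : {malg k[K]}) : V := \sum_(x <- msupp g) g@_x *: h x.

Lemma lin_extEw (d : {fset K}) g : (msupp g `<=` d)%fset ->
  lin_ext g = \sum_(x <- d) g@_x *: h x.
Proof.
move=> le; rewrite [LHS](big_fset_incl _ le) => //= x xd /mcoeff_outdom ->.
by rewrite scale0r.
Qed.

Lemma lin_extU x : lin_ext << x >> = h x.
Proof. by rewrite (lin_extEw msuppU_le) big_seq_fset1 mcoeffUU scale1r. Qed.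

Lemma lin_ext_linear : linear lin_ext.
Proof.
move=> a u v.
set E := (msupp u `|` msupp v `|` msupp (a *: u + v))%fset.
have uE : (msupp u `<=` E)%fset by rewrite /E -fsetUA fsubsetUl.
have vE : (msupp v `<=` E)%fset by rewrite /E (fsetUC (msupp u)) -fsetUA fsubsetUl.
have wE : (msupp (a *: u + v) `<=` E)%fset by rewrite /E fsubsetUr.
rewrite (lin_extEw uE) (lin_extEw vE) (lin_extEw wE).
rewrite scaler_sumr -big_split; apply: eq_bigr => x _ /=.
by rewrite scalerA -scalerDl mcoeffD mcoeffZ.
Qed.

End LinExt.

(* The free magma on C. [Star t s] is t * s: the planar tree in which the root
   of t is attached as the leftmost branch of the root of s. *)
Inductive OT (C : Type) : Type :=
| Node of C
| Star of OT C & OT C.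
Arguments Node {C}.
Arguments Star {C}.

HB.instance Definition _ (C : Type) := gen_eqMixin (OT C).
HB.instance Definition _ (C : Type) := gen_choiceMixin (OT C).

Section Grafting.
Context (k : fieldType) (C : Type).
Implicit Types (t s : OT C) (u v : {malg k[OT C]}).

Definition starM u v : {malg k[OT C]} :=
  lin_ext (fun t => lin_ext (fun s => << Star t s >>) v) u.

(* [graft_below t s] is the sum over i = 1..r of
   s_1 * (.. ((t |> s_i) * (.. (s_r * c)))), where s = s_1 * (.. (s_r * c)). *)
Fixpoint graft_below t s : {malg k[OT C]} :=
  match s with
  | Node _ => 0
  | Star s1 s' => starM (<< Star t s1 >> + graft_below t s1) << s' >>
                  + starM << s1 >> (graft_below t s')
  end.

Definition graft t s : {malg k[OT C]} := << Star t s >> + graft_below t s.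

Definition comb (ts : seq (OT C)) (c : C) : OT C := foldr Star (Node c) ts.

Lemma graft_node t c : graft t (Node c) = << Star t (Node c) >>.
Proof. by rewrite /graft addr0. Qed.

Lemma starM_linearl v : linear (starM^~ v).
Proof. exact: lin_ext_linear. Qed.

Lemma starM_linearr u : linear (starM u).
Proof.
move=> a v w; rewrite /starM {1 3 5}/lin_ext scaler_sumr -big_split.
by apply: eq_bigr => t _; rewrite lin_ext_linear scalerDr !scalerA mulrC.
Qed.

Lemma starMU t s : starM << t >> << s >> = << Star t s >>.
Proof. by rewrite /starM !lin_extU. Qed.

(* [comb [:: t_1; ..; t_r] c] is the factorization t_1 * (.. (t_r * c)). *)
Lemma graft_comb t ts c : graft t (comb ts c) =
  << Star t (comb ts c) >> +
  \sum_(i < size ts)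
     foldr (fun s => starM << s >>)
           (starM (graft t (nth t ts i)) << comb (drop i.+1 ts) c >>)
           (take i ts).
Proof.
rewrite /graft; congr (_ + _); elim: ts => [|s ts IH] /=; first by rewrite big_ord0.
rewrite big_ord_recl /= drop0 IH; congr (_ + _).
pose L := GRing.isLinear.Build _ _ _ _ _ (starM_linearr << s >>).
pose F : {linear {malg k[OT C]} -> {malg k[OT C]}} := HB.pack (starM << s >>) L.
exact: (raddf_sum F).
Qed.

End Grafting.

Section FreeLie.
Context (k : fieldType) (X : Type).

Inductive lie_term : Type :=
| LGen of X
| LZero
| LAdd of lie_term & lie_term
| LScale of k & lie_term
| LLie of lie_term & lie_term.

(* The congruence on formal expressions generated by the axioms of k-Lie
   algebras; the free Lie algebra is the quotient. *)
Inductive lie_eq : lie_term -> lie_term -> Prop :=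
| lie_eq_refl a : lie_eq a a
| lie_eq_sym a b : lie_eq a b -> lie_eq b a
| lie_eq_trans a b c : lie_eq a b -> lie_eq b c -> lie_eq a c
| lie_eq_add a a' b b' :
    lie_eq a a' -> lie_eq b b' -> lie_eq (LAdd a b) (LAdd a' b')
| lie_eq_scale l a a' : lie_eq a a' -> lie_eq (LScale l a) (LScale l a')
| lie_eq_lie a a' b b' :
    lie_eq a a' -> lie_eq b b' -> lie_eq (LLie a b) (LLie a' b')
| lie_eq_addA a b c : lie_eq (LAdd a (LAdd b c)) (LAdd (LAdd a b) c)
| lie_eq_addC a b : lie_eq (LAdd a b) (LAdd b a)
| lie_eq_add0 a : lie_eq (LAdd LZero a) a
| lie_eq_addN a : lie_eq (LAdd (LScale (-1) a) a) LZero
| lie_eq_scaleA l m a : lie_eq (LScale l (LScale m a)) (LScale (l * m) a)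
| lie_eq_scale1 a : lie_eq (LScale 1 a) a
| lie_eq_scaleDr l a b :
    lie_eq (LScale l (LAdd a b)) (LAdd (LScale l a) (LScale l b))
| lie_eq_scaleDl l m a :
    lie_eq (LScale (l + m) a) (LAdd (LScale l a) (LScale m a))
| lie_eq_lieDl l a b c :
    lie_eq (LLie (LAdd (LScale l a) b) c)
           (LAdd (LScale l (LLie a c)) (LLie b c))
| lie_eq_lieDr l a b c :
    lie_eq (LLie a (LAdd (LScale l b) c))
           (LAdd (LScale l (LLie a b)) (LLie a c))
| lie_eq_liexx a : lie_eq (LLie a a) LZero
| lie_eq_jacobi a b c :
    lie_eq (LAdd (LAdd (LLie a (LLie b c)) (LLie b (LLie c a)))
                 (LLie c (LLie a b)))
           LZero.

HB.instance Definition _ := gen_eqMixin lie_term.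
HB.instance Definition _ := gen_choiceMixin lie_term.

Definition lie_eqb (a b : lie_term) : bool := `[< lie_eq a b >].

Lemma lie_eqb_refl : reflexive lie_eqb.
Proof. by move=> a; apply/asboolP; exact: lie_eq_refl. Qed.

Lemma lie_eqb_sym : symmetric lie_eqb.
Proof. by move=> a b; apply/asboolP/asboolP; exact: lie_eq_sym. Qed.

Lemma lie_eqb_trans : transitive lie_eqb.
Proof.
by move=> b a c /asboolP ab /asboolP bc; apply/asboolP; exact: lie_eq_trans bc.
Qed.

Canonical lie_equiv := EquivRel lie_eqb lie_eqb_refl lie_eqb_sym lie_eqb_trans.

Definition freeLie : Type := {eq_quot lie_equiv}%qT.

HB.instance Definition _ := Choice.on freeLie.

Definition fl_pi (a : lie_term) : freeLie := (\pi_({eq_quot lie_equiv}%qT) a)%qT.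
Definition fl_repr (x : freeLie) : lie_term := repr (x : {eq_quot lie_equiv}%qT).

Lemma fl_reprK : cancel fl_repr fl_pi.
Proof. by move=> x; exact: reprK. Qed.

Lemma fl_piP a b : lie_eq a b <-> fl_pi a = fl_pi b.
Proof.
split=> [ab|/(@eqquotP _ _ {eq_quot lie_equiv}%qT) /asboolP //].
by apply/(@eqquotP _ _ {eq_quot lie_equiv}%qT)/asboolP.
Qed.

Lemma fl_repr_pi a : lie_eq (fl_repr (fl_pi a)) a.
Proof. by apply/fl_piP; rewrite fl_reprK. Qed.

Definition fl_add (x y : freeLie) := fl_pi (LAdd (fl_repr x) (fl_repr y)).
Definition fl_scale (l : k) (x : freeLie) := fl_pi (LScale l (fl_repr x)).
Definition fl_lie (x y : freeLie) := fl_pi (LLie (fl_repr x) (fl_repr y)).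

Lemma fl_addE a b : fl_add (fl_pi a) (fl_pi b) = fl_pi (LAdd a b).
Proof. by apply/fl_piP; apply: lie_eq_add; exact: fl_repr_pi. Qed.
Lemma fl_scaleE l a : fl_scale l (fl_pi a) = fl_pi (LScale l a).
Proof. by apply/fl_piP; apply: lie_eq_scale; exact: fl_repr_pi. Qed.
Lemma fl_lieE a b : fl_lie (fl_pi a) (fl_pi b) = fl_pi (LLie a b).
Proof. by apply/fl_piP; apply: lie_eq_lie; exact: fl_repr_pi. Qed.

Lemma fl_ind_pi (P : freeLie -> Prop) : (forall a, P (fl_pi a)) -> forall x, P x.
Proof. by move=> H x; rewrite -[x]fl_reprK. Qed.

Fact fl_addA : associative fl_add.
Proof.
elim/fl_ind_pi=> a; elim/fl_ind_pi=> b; elim/fl_ind_pi=> c.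
by rewrite !fl_addE; apply/fl_piP; constructor.
Qed.
Fact fl_addC : commutative fl_add.
Proof.
by elim/fl_ind_pi=> a; elim/fl_ind_pi=> b; rewrite !fl_addE; apply/fl_piP; constructor.
Qed.
Fact fl_add0 : left_id (fl_pi LZero) fl_add.
Proof. by elim/fl_ind_pi=> a; rewrite !fl_addE; apply/fl_piP; constructor. Qed.
Fact fl_addN : left_inverse (fl_pi LZero) (fl_scale (-1)) fl_add.
Proof.
by elim/fl_ind_pi=> a; rewrite fl_scaleE !fl_addE; apply/fl_piP; constructor.
Qed.

HB.instance Definition _ := GRing.isZmodule.Build freeLie
  fl_addA fl_addC fl_add0 fl_addN.

Lemma fl_piD a b : fl_pi (LAdd a b) = fl_pi a + fl_pi b.
Proof. by rewrite -fl_addE. Qed.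

Fact fl_scaleA l m x : fl_scale l (fl_scale m x) = fl_scale (l * m) x.
Proof.
by elim/fl_ind_pi: x => a; rewrite !fl_scaleE; apply/fl_piP; constructor.
Qed.
Fact fl_scale1 : left_id 1 fl_scale.
Proof. by elim/fl_ind_pi=> a; rewrite fl_scaleE; apply/fl_piP; constructor. Qed.
Fact fl_scaleDr : right_distributive fl_scale +%R.
Proof.
move=> l; elim/fl_ind_pi=> a; elim/fl_ind_pi=> b.
by rewrite -fl_piD !fl_scaleE -fl_piD; apply/fl_piP; constructor.
Qed.
Fact fl_scaleDl x : {morph fl_scale^~ x : l m / l + m}.
Proof.
move=> l m; elim/fl_ind_pi: x => a.
by rewrite !fl_scaleE -fl_piD; apply/fl_piP; constructor.
Qed.

HB.instance Definition _ := GRing.Zmodule_isLmodule.Build k freeLie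
  fl_scaleA fl_scale1 fl_scaleDr fl_scaleDl.

Lemma fl_piZ l a : fl_pi (LScale l a) = l *: fl_pi a.
Proof. by rewrite -fl_scaleE. Qed.

Fact fl_lie_linearl y : linear (fl_lie^~ y).
Proof.
move=> l; elim/fl_ind_pi: y => c; elim/fl_ind_pi=> a; elim/fl_ind_pi=> b.
rewrite -[l *: fl_pi a]fl_piZ -fl_piD !fl_lieE -fl_piZ -fl_piD.
by apply/fl_piP; constructor.
Qed.
Fact fl_lie_linearr x : linear (fl_lie x).
Proof.
move=> l; elim/fl_ind_pi: x => c; elim/fl_ind_pi=> a; elim/fl_ind_pi=> b.
rewrite -[l *: _]fl_piZ -fl_piD !fl_lieE -fl_piZ -fl_piD.
by apply/fl_piP; constructor.
Qed.
Fact fl_liexx x : fl_lie x x = 0.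
Proof. by elim/fl_ind_pi: x => a; rewrite fl_lieE; apply/fl_piP; constructor. Qed.
Fact fl_jacobi x y z :
  fl_lie x (fl_lie y z) + fl_lie y (fl_lie z x) + fl_lie z (fl_lie x y) = 0.
Proof.
elim/fl_ind_pi: x => a; elim/fl_ind_pi: y => b; elim/fl_ind_pi: z => c.
rewrite !fl_lieE -!fl_piD.
by apply/fl_piP; constructor.
Qed.

HB.instance Definition _ := Lmodule_isLieAlgebra.Build k freeLie
  fl_lie_linearl fl_lie_linearr fl_liexx fl_jacobi.

Lemma fl_piL a b : fl_pi (LLie a b) = [Lie fl_pi a, fl_pi b].
Proof. by rewrite -fl_lieE. Qed.

Definition fl_gen (x : X) : freeLie := fl_pi (LGen x).

Lemma freeLie_ind (P : freeLie -> Prop) :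
  (forall x, P (fl_gen x)) -> P 0 ->
  (forall x y, P x -> P y -> P (x + y)) ->
  (forall l x, P x -> P (l *: x)) ->
  (forall x y, P x -> P y -> P [Lie x, y]) ->
  forall x, P x.
Proof.
move=> Pg P0 Pa Ps Pl; elim/fl_ind_pi; elim=> [x||a ? b ?|l a ?|a ? b ?].
- exact: Pg.
- exact: P0.
- by rewrite fl_piD; apply: Pa.
- by rewrite fl_piZ; apply: Ps.
- by rewrite fl_piL; apply: Pl.
Qed.

Section Lift.
Context (L : lieAlgType k) (f : X -> L).

Fixpoint term_lift (a : lie_term) : L :=
  match a with
  | LGen x => f x
  | LZero => 0
  | LAdd a b => term_lift a + term_lift b
  | LScale l a => l *: term_lift a
  | LLie a b => [Lie term_lift a, term_lift b]
  end.

Lemma term_lift_eq a b : lie_eq a b -> term_lift a = term_lift b.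
Proof.
elim=> //=.
- by move=> ? ? ? _ -> _ ->.
- by move=> ? ? ? ? _ -> _ ->.
- by move=> ? ? ? _ ->.
- by move=> ? ? ? ? _ -> _ ->.
- by move=> *; rewrite addrA.
- by move=> *; rewrite addrC.
- by move=> *; rewrite add0r.
- by move=> *; rewrite scaleN1r addNr.
- by move=> *; rewrite scalerA.
- by move=> *; rewrite scale1r.
- by move=> *; rewrite scalerDr.
- by move=> *; rewrite scalerDl.
- by move=> l ? ? c; rewrite [LHS](lie_linearl _ l).
- by move=> l ? ? c; rewrite [LHS](lie_linearr _ l).
- by move=> *; rewrite liexx.
- by move=> *; rewrite lie_jacobi.
Qed.

Definition freeLie_lift (x : freeLie) : L := term_lift (fl_repr x).

Lemma freeLie_liftE a : freeLie_lift (fl_pi a) = term_lift a.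
Proof. by apply: term_lift_eq; exact: fl_repr_pi. Qed.

Lemma freeLie_lift_gen x : freeLie_lift (fl_gen x) = f x.
Proof. exact: freeLie_liftE. Qed.

Lemma freeLie_lift_morphism : is_lie_morphism freeLie_lift.
Proof.
split=> [l|]; elim/fl_ind_pi=> a; elim/fl_ind_pi=> b; last first.
  by rewrite -fl_piL !freeLie_liftE.
by rewrite -fl_piZ -fl_piD !freeLie_liftE.
Qed.

Lemma freeLie_universal :
  exists! F : freeLie -> L, is_lie_morphism F /\ forall x, F (fl_gen x) = f x.
Proof.
exists freeLie_lift; split.
  by split; [exact: freeLie_lift_morphism | exact: freeLie_lift_gen].
move=> G [[Gl Gb] Gf]; apply/funext; have [Fl Fb] := freeLie_lift_morphism.
have G0 : G 0 = 0 by have := Gl (-1) 0 0; rewrite scaleN1r addNr scaleN1r addNr.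
have F0 : freeLie_lift 0 = 0.
  by have := Fl (-1) 0 0; rewrite scaleN1r addNr scaleN1r addNr.
elim/freeLie_ind=> [x||x y Fx Fy|l x Fx|x y Fx Fy].
- by rewrite freeLie_lift_gen Gf.
- by rewrite F0 G0.
- by have := Gl 1 x y; have := Fl 1 x y; rewrite !scale1r => -> ->; rewrite Fx Fy.
- by have := Gl l x 0; have := Fl l x 0; rewrite !addr0 F0 G0 !addr0 => -> ->; rewrite Fx.
- by rewrite Fb Gb Fx Fy.
Qed.

End Lift.
End FreeLie.
Section LinearFacts.
Context (k : fieldType) (U V : lmodType k) (F : U -> V) (Fl : linear F).

Lemma lin0 : F 0 = 0.
Proof. by have := Fl (-1) 0 0; rewrite scaleN1r addNr scaleN1r addNr. Qed.
Lemma linD x y : F (x + y) = F x + F y.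
Proof. by have := Fl 1 x y; rewrite !scale1r. Qed.
Lemma linZ l x : F (l *: x) = l *: F x.
Proof. by have := Fl l x 0; rewrite lin0 !addr0. Qed.
Lemma linN x : F (- x) = - F x.
Proof. by rewrite -scaleN1r linZ scaleN1r. Qed.
Lemma linB x y : F (x - y) = F x - F y.
Proof. by rewrite linD linN. Qed.

End LinearFacts.

Lemma linearDZ (k : fieldType) (U V : lmodType k) (F : U -> V) :
  {morph F : x y / x + y} -> (forall l x, F (l *: x) = l *: F x) -> linear F.
Proof. by move=> FD FZ l x y; rewrite FD FZ. Qed.

Section LieFacts.
Context (k : fieldType) (L : lieAlgType k).
Implicit Types x y z : L.

Lemma lie0l y : [Lie 0, y] = 0. Proof. exact: (lin0 (lie_linearl y)). Qed.
Lemma lie0r x : [Lie x, 0] = 0. Proof. exact: (lin0 (lie_linearr x)). Qed.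
Lemma lieDl x y z : [Lie x + y, z] = [Lie x, z] + [Lie y, z].
Proof. exact: (linD (lie_linearl z)). Qed.
Lemma lieDr x y z : [Lie x, y + z] = [Lie x, y] + [Lie x, z].
Proof. exact: (linD (lie_linearr x)). Qed.
Lemma lieNl x y : [Lie - x, y] = - [Lie x, y].
Proof. exact: (linN (lie_linearl y)). Qed.
Lemma lieNr x y : [Lie x, - y] = - [Lie x, y].
Proof. exact: (linN (lie_linearr x)). Qed.
Lemma lieZl l x y : [Lie l *: x, y] = l *: [Lie x, y].
Proof. exact: (linZ (lie_linearl y)). Qed.
Lemma lieZr l x y : [Lie x, l *: y] = l *: [Lie x, y].
Proof. exact: (linZ (lie_linearr x)). Qed.
Lemma lieC x y : [Lie x, y] = - [Lie y, x].
Proof.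
apply/eqP; rewrite -addr_eq0; have := liexx (x + y).
by rewrite lieDl !lieDr !liexx addr0 add0r => ->.
Qed.

End LieFacts.

Lemma sum3_eq0 (V : zmodType) (a b c : V) :
  a = 0 -> b = 0 -> c = 0 -> a + b + c = 0.
Proof. by move=> -> -> ->; rewrite !addr0. Qed.

Inductive pick_spec (V : zmodType) (u r r' : V) : Prop := PickSpec of r = u + r'.

Lemma pick_here (V : zmodType) (u r : V) : pick_spec u (u + r) r.
Proof. by []. Qed.
Lemma pick_last (V : zmodType) (u : V) : pick_spec u u 0.
Proof. by split; rewrite addr0. Qed.
Lemma pick_there (V : zmodType) (u a r r' : V) :
  pick_spec u r r' -> pick_spec u (a + r) (a + r').
Proof. by case=> ->; split; rewrite addrCA. Qed.
Lemma cancel_pos (V : zmodType) (t r r' : V) :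
  pick_spec (- t) r r' -> r' = 0 -> t + r = 0.
Proof. by case=> -> ->; rewrite addr0 subrr. Qed.
Lemma cancel_neg (V : zmodType) (t r r' : V) :
  pick_spec t r r' -> r' = 0 -> - t + r = 0.
Proof. by case=> -> ->; rewrite addr0 addNr. Qed.

Ltac pick_tac :=
  first [exact: pick_here | exact: pick_last | apply: pick_there; pick_tac].
Ltac zcancel_loop :=
  lazymatch goal with
  | |- 0 = 0 => reflexivity
  | |- - ?t + _ = 0 => apply: cancel_neg; [pick_tac|zcancel_loop]
  | |- ?t + _ = 0 => apply: cancel_pos; [pick_tac|zcancel_loop]
  end.
Ltac zcancel := rewrite ?opprD ?opprK -?addrA ?(addr0, add0r) ?oppr0; zcancel_loop.

(* Dual numbers L + eps L: a Lie morphism x |-> x + eps D x is a derivation D. *)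
Definition dual_lie (k : fieldType) (L : lieAlgType k) : Type := (L * L)%type.

Section DualLie.
Context (k : fieldType) (L : lieAlgType k).
Local Notation dL := (dual_lie L).

HB.instance Definition _ := GRing.Lmodule.copy dL (L * L)%type.

Definition dual_bracket (p q : dL) : dL :=
  ([Lie p.1, q.1], [Lie p.2, q.1] + [Lie p.1, q.2]).

Fact dual_linearl q : linear (dual_bracket^~ q).
Proof.
move=> l [x x'] [y y']; case: q => z z'; congr (_, _) => /=.
  exact: lie_linearl.
by rewrite !lieDl !lieZl scalerDr !addrA; congr (_ + _); rewrite addrAC.
Qed.

Fact dual_linearr p : linear (dual_bracket p).
Proof.
move=> l [x x'] [y y']; case: p => z z'; congr (_, _) => /=.
  exact: lie_linearr.
by rewrite !lieDr !lieZr scalerDr !addrA; congr (_ + _); rewrite addrAC.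
Qed.

Fact dual_xx p : dual_bracket p p = 0.
Proof.
case: p => x x'; congr (_, _) => /=; first exact: liexx.
by rewrite [X in X + _]lieC addNr.
Qed.

Fact dual_jacobi p q r : dual_bracket p (dual_bracket q r) +
  dual_bracket q (dual_bracket r p) + dual_bracket r (dual_bracket p q) = 0.
Proof.
case: p q r => [x x'] [y y'] [z z']; congr (_, _) => /=; first exact: lie_jacobi.
have := lie_jacobi x' y z; have := lie_jacobi x y' z; have := lie_jacobi x y z'.
rewrite !lieDr => e1 e2 e3; apply: etrans (sum3_eq0 e1 e2 e3).
by apply/eqP; rewrite -subr_eq0; apply/eqP; zcancel.
Qed.

HB.instance Definition _ := Lmodule_isLieAlgebra.Build k dL
  dual_linearl dual_linearr dual_xx dual_jacobi.

End DualLie.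

Definition is_derivation (k : fieldType) (L : lieAlgType k) (D : L -> L) : Prop :=
  linear D /\ forall x y, D [Lie x, y] = [Lie D x, y] + [Lie x, D y].

Lemma freeLie_derivation (k : fieldType) (X : Type) (d : X -> freeLie k X) :
  exists2 D, is_derivation D & forall x, D (fl_gen k x) = d x.
Proof.
set L := freeLie k X.
pose f (x : X) : dual_lie L := (fl_gen k x, d x).
have [F [[[Fl Fb] Ff] _]] := freeLie_universal f.
have F1 x : (F x).1 = x.
  elim/freeLie_ind: x => [x||x y Hx Hy|l x Hx|x y Hx Hy].
  - by rewrite Ff.
  - by rewrite (lin0 Fl).
  - by rewrite (linD Fl) /= Hx Hy.
  - by rewrite (linZ Fl) /= Hx.
  - by rewrite Fb /= Hx Hy.
exists (fun x => (F x).2); last by move=> x; rewrite Ff.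
split; first by move=> l x y; rewrite Fl.
by move=> x y; rewrite Fb /= !F1.
Qed.

(* Semidirect product of L by its derivations:
   [(x, D), (y, E)] = ([x, y] + D y - E x, [D, E]). *)
Section SemiDirect.
Context (k : fieldType) (L : lieAlgType k).

Definition sdp_pred : {pred L * (L -> L)} := fun p => `[< is_derivation p.2 >].

Fact sdp_closed : GRing.subsemimod_closed sdp_pred.
Proof.
have H0 : is_derivation (fun _ : L => 0 : L).
  by split=> [l|] x y; rewrite ?scaler0 ?lie0l ?lie0r addr0.
split; first split.
- exact/asboolP.
- move=> p q /asboolP[pl pd] /asboolP[ql qd]; apply/asboolP.
  have E x : (p + q).2 x = p.2 x + q.2 x by [].
  split=> [l|] x y; first by rewrite !E pl ql scalerDr addrACA.
  by rewrite !E pd qd lieDl lieDr addrACA.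
- move=> l p /asboolP[pl pd]; apply/asboolP.
  have E x : (l *: p).2 x = l *: p.2 x by [].
  split=> [m|] x y; first by rewrite !E pl scalerDr !scalerA mulrC.
  by rewrite !E pd lieZl lieZr scalerDr.
Qed.

Record sdp := Sdp { sdp_val : L * (L -> L); _ : sdp_pred sdp_val }.
HB.instance Definition _ := [isSub for sdp_val].
HB.instance Definition _ := [Choice of sdp by <:].
HB.instance Definition _ :=
  GRing.SubChoice_isSubLmodule.Build k _ sdp_pred sdp sdp_closed.

Definition sdp1 (p : sdp) : L := (val p).1.
Definition sdp2 (p : sdp) : L -> L := (val p).2.

Lemma sdp2P p : is_derivation (sdp2 p).
Proof. by apply/asboolP; exact: valP p. Qed.

Lemma sdp_ext p q : sdp1 p = sdp1 q -> sdp2 p =1 sdp2 q -> p = q.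
Proof.
move=> e1 /funext e2; apply: val_inj; move: e1 e2; rewrite /sdp1 /sdp2.
by case: (val p) (val q) => [? ?] [? ?] /= -> ->.
Qed.

Lemma sdp1D p q : sdp1 (p + q) = sdp1 p + sdp1 q. Proof. by []. Qed.
Lemma sdp1Z l p : sdp1 (l *: p) = l *: sdp1 p. Proof. by []. Qed.
Lemma sdp2D p q x : sdp2 (p + q) x = sdp2 p x + sdp2 q x. Proof. by []. Qed.
Lemma sdp2Z l p x : sdp2 (l *: p) x = l *: sdp2 p x. Proof. by []. Qed.

Fact sdp_bracketP (p q : sdp) : sdp_pred
  ([Lie sdp1 p, sdp1 q] + (sdp2 p (sdp1 q) - sdp2 q (sdp1 p)),
   fun x => sdp2 p (sdp2 q x) - sdp2 q (sdp2 p x)).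
Proof.
apply/asboolP; have [pl pd] := sdp2P p; have [ql qd] := sdp2P q.
split=> [l|] x y /=.
  by rewrite !(pl, ql) scalerBr opprD addrACA.
rewrite qd pd (linD pl) (linD ql) !pd !qd !(lieDl, lieDr, lieNl, lieNr).
by apply/eqP; rewrite -subr_eq0; apply/eqP; zcancel.
Qed.

Definition sdp_bracket (p q : sdp) : sdp := Sdp (sdp_bracketP p q).

Lemma sdp_bracket1 p q : sdp1 (sdp_bracket p q) =
  [Lie sdp1 p, sdp1 q] + (sdp2 p (sdp1 q) - sdp2 q (sdp1 p)).
Proof. by []. Qed.
Lemma sdp_bracket2 p q x :
  sdp2 (sdp_bracket p q) x = sdp2 p (sdp2 q x) - sdp2 q (sdp2 p x).
Proof. by []. Qed.

Fact sdp_linearr p : linear (sdp_bracket p).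
Proof.
have [pl pd] := sdp2P p.
move=> l q r; apply: sdp_ext => [|x].
  rewrite sdp1D sdp1Z !sdp_bracket1 sdp1D sdp1Z lieDr lieZr sdp2D sdp2Z pl.
  rewrite !scalerDr scalerN.
  by apply/eqP; rewrite -subr_eq0; apply/eqP; zcancel.
rewrite sdp2D sdp2Z !sdp_bracket2 sdp2D sdp2Z pl sdp2D sdp2Z !scalerDr scalerN.
by apply/eqP; rewrite -subr_eq0; apply/eqP; zcancel.
Qed.

Fact sdp_bracketC p q : sdp_bracket p q = - sdp_bracket q p.
Proof.
rewrite -scaleN1r; apply: sdp_ext => [|x].
  by rewrite sdp1Z !sdp_bracket1 scaleN1r opprD opprB lieC.
by rewrite sdp2Z !sdp_bracket2 scaleN1r opprB.
Qed.

Fact sdp_linearl q : linear (sdp_bracket^~ q).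
Proof.
move=> l p r /=; rewrite (sdp_bracketC p) (sdp_bracketC r) (sdp_bracketC (_ + _)).
by rewrite sdp_linearr scalerN opprD.
Qed.

Fact sdp_xx p : sdp_bracket p p = 0.
Proof.
by apply: sdp_ext => [|x]; rewrite ?sdp_bracket1 ?sdp_bracket2 ?liexx ?add0r subrr.
Qed.

Fact sdp_jacobi p q r : sdp_bracket p (sdp_bracket q r) +
  sdp_bracket q (sdp_bracket r p) + sdp_bracket r (sdp_bracket p q) = 0.
Proof.
have [pl pd] := sdp2P p; have [ql qd] := sdp2P q; have [rl rd] := sdp2P r.
apply: sdp_ext => [|x].
  rewrite !sdp1D !(sdp_bracket1, sdp_bracket2) !lieDr.
  rewrite !(linD pl, linN pl, linD ql, linN ql, linD rl, linN rl) pd qd rd.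
  rewrite !lieNr.
  rewrite (lieC (sdp2 p (sdp1 q)) (sdp1 r)) (lieC (sdp2 q (sdp1 r)) (sdp1 p)).
  rewrite (lieC (sdp2 r (sdp1 p)) (sdp1 q)).
  apply: etrans (lie_jacobi (sdp1 p) (sdp1 q) (sdp1 r)).
  by apply/eqP; rewrite -subr_eq0; apply/eqP; zcancel.
rewrite !sdp2D !sdp_bracket2.
rewrite !(linD pl, linN pl, linD ql, linN ql, linD rl, linN rl).
by apply: (etrans _ (erefl 0)); zcancel.
Qed.

HB.instance Definition _ := Lmodule_isLieAlgebra.Build k sdp
  sdp_linearl sdp_linearr sdp_xx sdp_jacobi.

End SemiDirect.
Section Extension.
Context (k : fieldType) (X : Type).
Local Notation L := (freeLie k X).
Local Notation gen := (@fl_gen k X).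

Definition is_postLie_extension (gr : X -> X -> L) (op : L -> L -> L) : Prop :=
  [/\ (forall y, linear (op^~ y)) /\ (forall x, linear (op x)),
      forall s t, op (gen s) (gen t) = gr s t,
      forall x y z, op x [Lie y, z] = [Lie op x y, z] + [Lie y, op x z] &
      forall x y z, op [Lie x, y] z = associator op x y z - associator op y x z].

(* Span of the brackets of at most n generators. *)
Inductive filt : nat -> L -> Prop :=
| filt0 n : filt n 0
| filtD n x y : filt n x -> filt n y -> filt n (x + y)
| filtZ n l x : filt n x -> filt n (l *: x)
| filt_gen n x : filt n.+1 (gen x)
| filt_lie m n p x y : filt m x -> filt n y -> (m + n <= p)%N -> filt p [Lie x, y].

Lemma filtN n x : filt n x -> filt n (- x).
Proof. by rewrite -scaleN1r; apply: filtZ. Qed.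
Lemma filtB n x y : filt n x -> filt n y -> filt n (x - y).
Proof. by move=> ? /filtN; apply: filtD. Qed.

Lemma filtW m n x : filt m x -> (m <= n)%N -> filt n x.
Proof.
move=> H; elim: H n => {m x}.
- by move=> *; apply: filt0.
- by move=> m x y _ Hx _ Hy n mn; apply: filtD; auto.
- by move=> m l x _ Hx n mn; apply: filtZ; auto.
- by move=> m x [//|n] _; apply: filt_gen.
- by move=> m n p x y Hx _ Hy _ mn q pq; apply: filt_lie Hx Hy _; exact: leq_trans pq.
Qed.

Lemma filt_exists x : exists n, filt n x.
Proof.
elim/freeLie_ind: x => [x||x y [m Hx] [n Hy]|l x [n Hx]|x y [m Hx] [n Hy]].
- by exists 1%N; apply: filt_gen.
- by exists 0%N; apply: filt0.
- exists (m + n)%N; apply: filtD; [apply: filtW Hx _|apply: filtW Hy _];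
    by rewrite ?leq_addr ?leq_addl.
- by exists n; apply: filtZ.
- by exists (m + n)%N; apply: filt_lie Hx Hy _.
Qed.

Lemma filt_eq0 x : filt 0 x -> x = 0.
Proof.
move E: 0%N => n H; elim: H E => {n x} //.
- by move=> n x y _ Hx _ Hy E; rewrite Hx // Hy // addr0.
- by move=> n l x _ Hx E; rewrite Hx // scaler0.
- move=> m n p x y _ Hx _ _ + E; rewrite -E leqn0 addn_eq0 => /andP[/eqP m0 _].
  by rewrite Hx ?m0 // lie0l.
Qed.

Lemma derivation_filt (D : L -> L) : is_derivation D ->
  (forall t, filt 1 (D (gen t))) -> forall n x, filt n x -> filt n (D x).
Proof.
move=> [Dl Dd] Dg n x; elim=> {n x}.
- by move=> n; rewrite (lin0 Dl); apply: filt0.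
- by move=> n x y _ Hx _ Hy; rewrite (linD Dl); apply: filtD.
- by move=> n l x _ Hx; rewrite (linZ Dl); apply: filtZ.
- by move=> n x; apply: filtW (Dg x) _.
- move=> m n p x y Hx HDx Hy HDy mn; rewrite Dd; apply: filtD.
    exact: filt_lie HDx Hy mn.
  exact: filt_lie Hx HDy mn.
Qed.

Context (gr : X -> X -> L) (gr_filt : forall s t, filt 1 (gr s t)).

(* Let D_s be the derivation with D_s t = gr s t. The map s |-> (s, D_s) extends
   to a Lie morphism x |-> (th x, de x) into the semidirect product, th - id
   strictly lowers the filtration, so th is bijective, and the product is
   x |> y = de (th^-1 x) y. *)
Lemma postLie_extension_ex : exists op, is_postLie_extension gr op.
Proof.
pose D s := projT1 (cid2 (freeLie_derivation (gr s))).
have Dd s : is_derivation (D s) by rewrite /D; case: cid2.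
have Dg s t : D s (gen t) = gr s t by rewrite /D; case: cid2.
have DP s : sdp_pred (gen s, D s) by apply/asboolP; exact: Dd.
have [F [[[Fl Fb] Fg] _]] := freeLie_universal (fun s => Sdp (DP s)).
pose th x := sdp1 (F x); pose de x := sdp2 (F x).
have ded x : is_derivation (de x) by exact: sdp2P.
have thl : linear th by move=> l x y; rewrite /th Fl sdp1D sdp1Z.
have del y : linear (de^~ y) by move=> l x z; rewrite /de Fl sdp2D sdp2Z.
have thg s : th (gen s) = gen s by rewrite /th Fg.
have deg s : de (gen s) = D s by rewrite /de Fg.
have thb x y : th [Lie x, y] = [Lie th x, th y] + (de x (th y) - de y (th x)).
  by rewrite /th Fb sdp_bracket1.
have deb x y z : de [Lie x, y] z = de x (de y z) - de y (de x z).
  by rewrite /de Fb sdp_bracket2.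
have def x n y : filt n y -> filt n (de x y).
  move=> Hy; elim/freeLie_ind: x n y Hy => [s||x y Hx Hy|l x Hx|x y Hx Hy] n z Hz.
  - rewrite deg; apply: derivation_filt (Dd s) _ _ _ Hz => t.
    by rewrite Dg; apply: gr_filt.
  - by rewrite (lin0 (del z)); apply: filt0.
  - by rewrite (linD (del z)); apply: filtD; auto.
  - by rewrite (linZ (del z)); apply: filtZ; auto.
  - by rewrite deb; apply: filtB; auto.
have thf n x : filt n x -> filt n (th x) /\ filt n.-1 (th x - x).
  elim=> {n x}.
  - by move=> n; rewrite (lin0 thl) subr0; split; apply: filt0.
  - move=> n x y _ [H1 H2] _ [H3 H4]; rewrite (linD thl) opprD addrACA.
    by split; apply: filtD.
  - move=> n l x _ [H1 H2]; rewrite (linZ thl) -scalerBr.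
    by split; apply: filtZ.
  - by move=> n s; rewrite thg subrr; split; [apply: filt_gen|apply: filt0].
  - move=> m n p x y Hx [Tx Nx] Hy [Ty Ny] mnp.
    suff H : filt p.-1 (th [Lie x, y] - [Lie x, y]).
      split=> //; rewrite -[th _](subrK [Lie x, y]); apply: filtD.
        by apply: filtW H _; apply: leq_pred.
      exact: filt_lie Hx Hy mnp.
    case: m Hx Tx Nx mnp => [|m] Hx Tx Nx mnp.
      by rewrite (filt_eq0 Hx) lie0l (lin0 thl) subr0; apply: filt0.
    case: n Hy Ty Ny mnp => [|n] Hy Ty Ny mnp.
      by rewrite (filt_eq0 Hy) lie0r (lin0 thl) subr0; apply: filt0.
    have -> : th [Lie x, y] - [Lie x, y] =
        [Lie th x - x, th y] + [Lie x, th y - y] + (de x (th y) - de y (th x)).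
      rewrite thb lieDl lieDr lieNl lieNr.
      by apply/eqP; rewrite -subr_eq0; apply/eqP; zcancel.
    case: p mnp => // p; rewrite /= addSn ltnS => mnp.
    apply: filtD; first apply: filtD.
    + exact: filt_lie Nx Ty mnp.
    + by apply: filt_lie Hx Ny _; rewrite /= addSn -addnS.
    apply: filtB; apply: def; [apply: filtW Ty _|apply: filtW Tx _].
      exact: leq_trans (leq_addl _ _) mnp.
    by apply: leq_trans mnp; rewrite addnS ltnS leq_addr.
have th_inj x : th x = 0 -> x = 0.
  move=> thx; have [n] := filt_exists x; elim: n => [|n IH Hx]; first exact: filt_eq0.
  apply: IH; have [_] := thf _ _ Hx; rewrite thx sub0r => /filtN.
  by rewrite opprK.
have th_surj y : exists x, th x = y.
  have [n] := filt_exists y; elim: n y => [|n IH] y Hy.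
    by exists 0; rewrite (lin0 thl) (filt_eq0 Hy).
  have [_ /IH[z Hz]] := thf _ _ Hy.
  by exists (y - z); rewrite (linB thl) Hz opprB addrC subrK.
pose ps y := projT1 (cid (th_surj y)).
have psK y : th (ps y) = y by rewrite /ps; case: cid.
have thK x : ps (th x) = x.
  by apply/eqP; rewrite -subr_eq0; apply/eqP/th_inj; rewrite (linB thl) psK subrr.
have psl : linear ps.
  by move=> l x y; rewrite -[RHS]thK thl !psK.
exists (fun x y => de (ps x) y); split.
- split=> [y l x z|x]; first by rewrite psl (del y).
  by case: (ded (ps x)).
- by move=> s t; rewrite -(thg s) thK deg Dg.
- by move=> x y z; case: (ded (ps x)) => _ ->.
move=> x y z; have := thb (ps x) (ps y); rewrite !psK => E.
have {}E : ps [Lie x, y] = [Lie ps x, ps y] - ps (de (ps x) y) + ps (de (ps y) x).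
  rewrite -[LHS]addr0 -[X in _ + X](lin0 psl).
  rewrite -[[Lie ps x, ps y]]thK E !(linD psl, linN psl).
  by apply/eqP; rewrite -subr_eq0 (lin0 psl); apply/eqP; zcancel.
rewrite E (linD (del z)) (linB (del z)) deb /associator.
by apply/eqP; rewrite -subr_eq0; apply/eqP; zcancel.
Qed.

Lemma postLie_extension_uniq op op' :
  is_postLie_extension gr op -> is_postLie_extension gr op' ->
  forall x y, op x y = op' x y.
Proof.
move=> [[opl opr] opg opd opa] [[opl' opr'] opg' opd' opa'] x y.
pose P x := (forall n y, filt n y -> filt n (op x y)) /\ forall y, op x y = op' x y.
suff H m u : filt m u -> P u by have [m /H[_ ->]] := filt_exists x.
have P0 : P 0.
  split=> [n|] z; first by rewrite (lin0 (opl z)) => _; apply: filt0.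
  by rewrite (lin0 (opl z)) (lin0 (opl' z)).
elim: m u => [|m IH] u; first by move/filt_eq0->.
move Em : m.+1 => q Hu; have {Em} : (q <= m.+1)%N by rewrite Em.
elim: Hu => {q u} [//|q a b _ Ha _ Hb qm|q l a _ Ha qm|q s _|].
- have [Fa Ea] := Ha qm; have [Fb Eb] := Hb qm; split=> [n|] z.
    by rewrite (linD (opl z)) => ?; apply: filtD; auto.
  by rewrite (linD (opl z)) (linD (opl' z)) Ea Eb.
- have [Fa Ea] := Ha qm; split=> [n|] z.
    by rewrite (linZ (opl z)) => ?; apply: filtZ; auto.
  by rewrite (linZ (opl z)) (linZ (opl' z)) Ea.
- split.
    apply: derivation_filt; first by split; [exact: opr | exact: opd].
    by move=> t; rewrite opg.
  elim/freeLie_ind=> [t||a b Ha Hb|l a Ha|a b Ha Hb].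
  + by rewrite opg opg'.
  + by rewrite (lin0 (opr _)) (lin0 (opr' _)).
  + by rewrite (linD (opr _)) (linD (opr' _)) Ha Hb.
  + by rewrite (linZ (opr _)) (linZ (opr' _)) Ha.
  + by rewrite opd opd' Ha Hb.
- move=> i j p a b Ha _ Hb _ ijp pm.
  case: i Ha ijp => [|i] Ha ijp; first by rewrite (filt_eq0 Ha) lie0l.
  case: j Hb ijp => [|j] Hb ijp; first by rewrite (filt_eq0 Hb) lie0r.
  have ijm : (i + j < m)%N.
    by have := leq_trans ijp pm; rewrite addSn addnS !ltnS.
  have im : (i.+1 <= m)%N by apply: leq_ltn_trans ijm; rewrite leq_addr.
  have jm : (j.+1 <= m)%N by apply: leq_ltn_trans ijm; rewrite leq_addl.
  have [Fa Ea] := IH _ (filtW Ha im); have [Fb Eb] := IH _ (filtW Hb jm).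
  have [Fab Eab] := IH _ (filtW (Fa _ _ Hb) jm).
  have [Fba Eba] := IH _ (filtW (Fb _ _ Ha) im).
  split=> [n|] z; rewrite opa /associator; first by move=> Hz; do !apply: filtB; auto.
  by rewrite opa' /associator Eab Eba !Ea !Eb.
Qed.

Lemma postLie_extension_exists_unique : exists! op, is_postLie_extension gr op.
Proof.
have [op H] := postLie_extension_ex; exists op; split=> // op' H'.
by do 2!apply/funext=> ?; apply: postLie_extension_uniq.
Qed.

End Extension.

Section PostLieC.
Context (k : fieldType) (C : Type).
Local Notation g := (freeLie k (OT C)).

Definition graft_lie (t s : OT C) : g := lin_ext (@fl_gen k (OT C)) (graft k t s).

Lemma graft_lie_filt t s : filt 1 (graft_lie t s).
Proof.
rewrite /graft_lie /lin_ext; elim/big_rec: _ => [|r x _]; first exact: filt0.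
by apply: filtD; apply/filtZ/filt_gen.
Qed.

Definition postLie : Type := g.

HB.instance Definition _ := LieAlgebra.copy postLie g.

(* The unique bilinear product on the free Lie algebra over OT C that extends
   left grafting of trees and satisfies the two post-Lie identities. *)
Definition postLie_tri : postLie -> postLie -> postLie :=
  sval (cid (postLie_extension_exists_unique graft_lie_filt)).

Lemma postLie_triP : is_postLie_extension graft_lie postLie_tri.
Proof. by rewrite /postLie_tri; case: cid => ? []. Qed.

Fact postLie_tri_linearl y : linear (postLie_tri^~ y).
Proof. by case: postLie_triP => -[]. Qed.
Fact postLie_tri_linearr x : linear (postLie_tri x).
Proof. by case: postLie_triP => -[]. Qed.
Fact postLie_tri_lier x y z :
  postLie_tri x [Lie y, z] = [Lie postLie_tri x y, z] + [Lie y, postLie_tri x z].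
Proof. by case: postLie_triP. Qed.
Fact postLie_tri_liel x y z : postLie_tri [Lie x, y] z =
  associator postLie_tri x y z - associator postLie_tri y x z.
Proof. by case: postLie_triP. Qed.

HB.instance Definition _ := LieAlgebra_isPostLie.Build k postLie
  postLie_tri_linearl postLie_tri_linearr postLie_tri_lier postLie_tri_liel.

Definition of_tree (t : OT C) : postLie := fl_gen k t.

Definition of_colour (c : C) : postLie := of_tree (Node c).

Lemma tri_of_tree t s : of_tree t |> of_tree s = lin_ext of_tree (graft k t s).
Proof. by case: postLie_triP. Qed.

End PostLieC.

Arguments of_tree k {C} t.
Arguments of_colour k {C} c.

(* Main.v *)
(* In postLie(C) a planar tree satisfies t * s = t |> s - B(t, s), where
   B(t, s) is the sum of the graftings of t on s away from the root. All trees
   in B(t, s) have as many nodes as t * s but a root of smaller arity, so this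
   is a recursion determining a morphism on trees from its values on C. The
   resulting map extends to the free Lie algebra, and the extension preserves
   |> because the left argument of |> reduces to trees: y |> z is no longer, as a
   combination of brackets, than z, so [x, y] |> w is expressed through shorter
   left arguments. *)
Require Import Defs.
From mathcomp Require Import all_boot all_order all_algebra.
From mathcomp Require Import finmap boolp monalg zify.

Set Implicit Arguments.
Unset Strict Implicit.
Unset Printing Implicit Defensive.

Import GRing.Theory.
Local Open Scope ring_scope.

Section LinExtSupport.
Context (k : fieldType) (K : choiceType).

Lemma eq_lin_ext (V : lmodType k) (h h' : K -> V) (u : {malg k[K]}) :
  {in msupp u, h =1 h'} -> lin_ext h u = lin_ext h' u.
Proof.
by move=> hh'; rewrite /lin_ext; apply: eq_big_seq => x xu; rewrite hh'.
Qed.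

Lemma linear_lin_ext (V W : lmodType k) (F : V -> W) (h : K -> V)
    (u : {malg k[K]}) :
  linear F -> F (lin_ext h u) = lin_ext (F \o h) u.
Proof.
move=> Fl; rewrite /lin_ext (big_morph F (linD Fl) (lin0 Fl)).
by apply: eq_bigr => x _; rewrite (linZ Fl).
Qed.

Definition supported (P : K -> Prop) (u : {malg k[K]}) : Prop :=
  forall x, x \in msupp u -> P x.

Lemma supported0 P : supported P 0.
Proof. by move=> x; rewrite msupp0 inE. Qed.

Lemma supportedU (P : K -> Prop) x : P x -> supported P << x >>.
Proof. by move=> Px y /(fsubsetP msuppU_le); rewrite inE => /eqP ->. Qed.

Lemma supportedD P u v : supported P u -> supported P v -> supported P (u + v).
Proof.
by move=> Pu Pv x /(fsubsetP (msuppD_le _ _)); rewrite inE => /orP[/Pu|/Pv].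
Qed.

Lemma supportedZ P c u : supported P u -> supported P (c *: u).
Proof. by move=> Pu x /(fsubsetP (msuppZ_le c u)); apply: Pu. Qed.

End LinExtSupport.

Lemma supported_lin_ext (k : fieldType) (K K' : choiceType) (P : K -> Prop)
    (Q : K' -> Prop) (h : K -> {malg k[K']}) (u : {malg k[K]}) :
  supported P u -> (forall x, P x -> supported Q (h x)) ->
  supported Q (lin_ext h u).
Proof.
move=> Pu PQ; rewrite /lin_ext big_seq; elim/big_rec: _ => [|x v xu Qv].
  exact: supported0.
by apply: supportedD => //; apply: supportedZ; apply: PQ; apply: Pu.
Qed.

Section Trees.
Context (C : Type).

Fixpoint node_count (t : OT C) : nat :=
  if t is Star t1 t2 then node_count t1 + node_count t2 else 1.

Fixpoint root_arity (t : OT C) : nat :=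
  if t is Star _ t2 then (root_arity t2).+1 else 0.

Lemma root_arity_lt t : (root_arity t < node_count t)%N.
Proof. by elim: t => [c|t IHt s IHs] //=; lia. Qed.

(* Encodes the lexicographic order on (node_count, root_arity), since
   root_arity < node_count. *)
Definition tree_rank (t : OT C) : nat := (node_count t ^ 2 + root_arity t)%N.

(** A tree with n nodes has rank below (n + 1)^2, which bounds from below the rank of any tree with
    more nodes. *)
Lemma tree_rank_lt_count s t :
  (node_count s < node_count t)%N -> (tree_rank s < tree_rank t)%N.
Proof. by rewrite /tree_rank; have := root_arity_lt s; nia. Qed.

Lemma tree_rank_Starl t s : (tree_rank t < tree_rank (Star t s))%N.
Proof. by apply: tree_rank_lt_count; have := root_arity_lt s; rewrite /=; lia. Qed.

Lemma tree_rank_Starr t s : (tree_rank s < tree_rank (Star t s))%N.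
Proof. by apply: tree_rank_lt_count; have := root_arity_lt t; rewrite /=; lia. Qed.

Context (k : fieldType).

Lemma supported_starM (P Q R : OT C -> Prop) (u v : {malg k[OT C]}) :
  supported P u -> supported Q v -> (forall t s, P t -> Q s -> R (Star t s)) ->
  supported R (starM u v).
Proof.
move=> Pu Qv PQR; apply: supported_lin_ext Pu _ => t Pt.
by apply: supported_lin_ext Qv _ => s Qs; apply: supportedU; apply: PQR.
Qed.

(** Each of these graftings happens inside one branch of the root of [s], so the root keeps its
    number of branches. *)
Lemma supported_graft_below t s :
  supported (fun x => node_count x = (node_count t + node_count s)%N /\
                      root_arity x = root_arity s) (graft_below k t s).
Proof.
elim: s => [c|s1 IH1 s2 IH2] /=; first exact: supported0.
apply: supportedD.
  apply: (@supported_starM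
    (fun x => node_count x = (node_count t + node_count s1)%N) (eq s2)).
  - apply: supportedD; first exact: supportedU.
    by move=> x /IH1[].
  - exact: supportedU.
  - by move=> x _ /= -> <-; split => //; rewrite addnA.
apply: (supported_starM (P := eq s1) _ IH2); first exact: supportedU.
by move=> _ x <- [/= -> ->]; split => //; rewrite addnCA.
Qed.

Lemma tree_rank_graft_below t s x : x \in msupp (graft_below k t s) ->
  (tree_rank x < tree_rank (Star t s))%N.
Proof.
by move=> /supported_graft_below[E1 E2]; rewrite /tree_rank /= E1 E2 addnS.
Qed.

End Trees.

Section TreeMap.
Context (k : fieldType) (C : Type) (A : postLieType k) (f : C -> A).

(** What a post-Lie morphism extending [f] satisfies on trees. A linear extension suffices to state
    it, since grafting trees yields a combination of trees without brackets. *)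
Definition graft_compatible (h : OT C -> A) : Prop :=
  (forall c, h (Node c) = f c) /\
  forall t s, lin_ext h (graft k t s) = h t |> h s.

Lemma lin_ext_graft (h : OT C -> A) t s :
  lin_ext h (graft k t s) = h (Star t s) + lin_ext h (graft_below k t s).
Proof. by rewrite (linD (lin_ext_linear h)) lin_extU. Qed.

(** The recursion is on the fuel [n], since trees in [graft_below] are not subterms. The default 0
    is never reached when [n] exceeds the rank of [t], as the rank drops at each call. *)
Fixpoint tree_map_rec (n : nat) (t : OT C) : A :=
  if n is n'.+1 then
    match t with
    | Node c => f c
    | Star t1 t2 => tree_map_rec n' t1 |> tree_map_rec n' t2
                    - lin_ext (tree_map_rec n') (graft_below k t1 t2)
    end
  else 0.

Definition tree_map (t : OT C) : A := tree_map_rec (tree_rank t).+1 t.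

Lemma tree_map_recE n t : (tree_rank t < n)%N -> tree_map_rec n t = tree_map t.
Proof.
suff H m p s : (tree_rank s < m)%N -> (tree_rank s < p)%N ->
    tree_map_rec m s = tree_map_rec p s by move=> tn; apply: H.
elim: m p s => [|m IH] [|p] [c|s1 s2] //; rewrite !ltnS => sm sp /=.
have E x : (tree_rank x < tree_rank (Star s1 s2))%N ->
    tree_map_rec m x = tree_map_rec p x.
  by move=> xs; apply: IH; [exact: leq_trans sm|exact: leq_trans sp].
rewrite !E ?tree_rank_Starl ?tree_rank_Starr //; congr (_ - _).
by apply: eq_lin_ext => x /tree_rank_graft_below/E.
Qed.

Lemma tree_map_compatible : graft_compatible tree_map.
Proof.
split=> // t s; rewrite lin_ext_graft [X in X + _]/tree_map.
rewrite [tree_map_rec]lock /= -lock /=.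
rewrite !tree_map_recE ?tree_rank_Starl ?tree_rank_Starr // -addrA.
(* The correction term subtracted by the recursion and the one added by grafting differ only in
   fuel, so they cancel. *)
rewrite [X in _ + X](_ : _ = 0) ?addr0 //; apply/eqP; rewrite addrC subr_eq0.
apply/eqP/eq_lin_ext => x xu; rewrite tree_map_recE //.
exact: tree_rank_graft_below xu.
Qed.

(** Compatibility at [t] and [s] expresses the value at [Star t s] through values at trees of
    smaller rank. *)
Lemma graft_compatible_unique h h' :
  graft_compatible h -> graft_compatible h' -> h =1 h'.
Proof.
move=> [hN hS] [hN' hS'] t; have [n] := ubnP (tree_rank t).
elim: n t => // n IH [c|t s] tn; first by rewrite hN hN'.
have E x : (tree_rank x < tree_rank (Star t s))%N -> h x = h' x.
  by move=> xt; apply: IH; apply: leq_trans xt _.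
have := hS t s.
rewrite (E t) ?(E s) ?tree_rank_Starl ?tree_rank_Starr // -hS'.
rewrite !lin_ext_graft (@eq_lin_ext _ _ _ h h'); first exact: addIr.
by move=> x /tree_rank_graft_below/E.
Qed.

End TreeMap.

Section PostLieMorphisms.
Context (k : fieldType) (C : Type).
Implicit Types x y : postLie k C.

(** A tree acts by a derivation that sends trees to combinations of trees, so it lengthens no
    bracket. *)
Lemma tri_of_tree_filt t n x : filt n x -> filt n (of_tree k t |> x).
Proof.
apply: derivation_filt.
  by split; [exact: (tri_linearr (of_tree k t)) | exact: (tri_lier (of_tree k t))].
by move=> s; rewrite [X in filt _ X]tri_of_tree; apply: graft_lie_filt.
Qed.

(** The bracket case also supplies [x |> y] and [y |> x], because expanding [[Lie x, y] |> z] by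
    associators puts them on the left of [|>]. *)
Lemma postLie_ind (P : postLie k C -> Prop) :
  (forall t, P (of_tree k t)) -> P 0 ->
  (forall x y, P x -> P y -> P (x + y)) ->
  (forall l x, P x -> P (l *: x)) ->
  (forall x y, P x -> P y -> P (x |> y) -> P (y |> x) -> P [Lie x, y]) ->
  forall x, P x.
Proof.
move=> Pg P0 PD PZ PL x.
(* The added bound keeps [a |> b] as short as [b], within reach of the induction on bracket
   length. *)
pose Q u := (forall n y, filt n y -> filt n (u |> y)) /\ P u.
suff H m u : filt m u -> Q u by have [m /H[]] := filt_exists x.
have Q0 : Q 0.
  by split=> // n y _; rewrite (lin0 (tri_linearl y)); apply: filt0.
elim: m u => [|m IH] u; first by move/filt_eq0->.
move Em : m.+1 => q Hu; have {Em} : (q <= m.+1)%N by rewrite Em.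
elim: Hu => {q u} [//|q a b _ Ha _ Hb qm|q l a _ Ha qm|q t _|].
- have [Fa Pa] := Ha qm; have [Fb Pb] := Hb qm; split; last exact: PD.
  by move=> n y ny; rewrite (linD (tri_linearl y)); apply: filtD; auto.
- have [Fa Pa] := Ha qm; split; last exact: PZ.
  by move=> n y ny; rewrite (linZ (tri_linearl y)); apply: filtZ; auto.
- by split; [exact: tri_of_tree_filt | exact: Pg].
move=> i j p a b Ha _ Hb _ ijp pm.
(* A factor of filtration index 0 vanishes. Otherwise both indices are positive with sum at most
   [m.+1], so each is at most [m]. *)
case: i Ha ijp => [|i] Ha ijp; first by rewrite (filt_eq0 Ha) lie0l.
case: j Hb ijp => [|j] Hb ijp; first by rewrite (filt_eq0 Hb) lie0r.
have im : (i.+1 <= m)%N by lia.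
have jm : (j.+1 <= m)%N by lia.
have [Fa Pa] := IH _ (filtW Ha im); have [Fb Pb] := IH _ (filtW Hb jm).
have [Fab Pab] := IH _ (filtW (Fa _ _ Hb) jm).
have [Fba Pba] := IH _ (filtW (Fb _ _ Ha) im).
split; last exact: PL.
move=> n y ny; rewrite [X in filt _ X]tri_liel /associator.
by do !apply: filtB; auto.
Qed.

Context (A : postLieType k) (F : postLie k C -> A).

Lemma postLie_morphism_of_trees : is_lie_morphism F ->
  (forall t s, F (of_tree k t |> of_tree k s) = F (of_tree k t) |> F (of_tree k s)) ->
  is_postLie_morphism F.
Proof.
move=> [Fl Fb] Ft; split=> //.
elim/postLie_ind => [t||x y Hx Hy|l x Hx|x y Hx Hy Hxy Hyx] z.
(* A tree and its image both act by derivations, so agreement on trees spreads to all brackets. *)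
- elim/freeLie_ind: z => [s||y z Hy Hz|l y Hy|y z Hy Hz].
  + exact: Ft.
  + by rewrite (lin0 Fl) !(lin0 (tri_linearr _)) (lin0 Fl).
  + by rewrite (linD Fl) !(linD (tri_linearr _)) (linD Fl) Hy Hz.
  + by rewrite (linZ Fl) !(linZ (tri_linearr _)) (linZ Fl) Hy.
  + by rewrite [_ |> _ in LHS]tri_lier (linD Fl) !Fb Hy Hz -tri_lier.
- by rewrite (lin0 Fl) !(lin0 (tri_linearl _)) (lin0 Fl).
- by rewrite (linD Fl) !(linD (tri_linearl _)) (linD Fl) Hx Hy.
- by rewrite (linZ Fl) !(linZ (tri_linearl _)) (linZ Fl) Hx.
by rewrite Fb !tri_liel /associator !(linB Fl) !(Hx, Hy, Hxy, Hyx).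
Qed.

Lemma postLie_morphism_graft_compatible (f : C -> A) :
  is_postLie_morphism F -> (forall c, F (of_colour k c) = f c) ->
  graft_compatible f (F \o of_tree k).
Proof.
move=> [Fl _ Ft] Fc; split=> [c|t s]; first exact: Fc.
by rewrite -linear_lin_ext // -tri_of_tree Ft.
Qed.

End PostLieMorphisms.

Theorem theorem3p2 (k : fieldType) (char0 : [pchar k]%R =i pred0) (C : Type)
    (A : postLieType k) (f : C -> A) :
  exists! F : postLie k C -> A,
    is_postLie_morphism F /\ forall c : C, F (of_colour k c) = f c.
Proof.
have [F [[FL Fg] Funiq]] := freeLie_universal (tree_map f).
have [hN hS] := tree_map_compatible f.
exists F; split; first split.
- apply: postLie_morphism_of_trees => // t s.
  rewrite tri_of_tree (linear_lin_ext _ _ FL.1) !Fg -hS.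
  by apply: eq_lin_ext => x _; apply: Fg.
- by move=> c; rewrite [LHS]Fg hN.
(* A second morphism is compatible on trees, hence equals [tree_map] there, and Lie morphisms are
   determined by their values on trees. *)
move=> G [Gm Gc]; apply: Funiq; split; first by case: Gm.
exact: graft_compatible_unique (postLie_morphism_graft_compatible Gm Gc)
  (tree_map_compatible f).
Qed.
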